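(* Let $\Delta$ be a pure $(d-1)$-dimensional simplicial complex on a finite set $V$, let $L$ be a linear subspace of $\mathbb{R}^V$ such that $(\tau\Delta,L)$ is hereditary, and let $w$ be a real-valued function on the $d$-element subsets of $V$ which is nonzero precisely on the facets of $\Delta$. Then there is at most one hereditary polynomial $f\in\mathbb{R}[t_i:i\in V]$ with $\partial^Sf=w(S)$ for all $S\subseteq V$ with $|S|=d$, $\Delta_f=\Delta$, and $L\subseteq L_f$. Moreover, such a polynomial exists if and only if for each facet $F$ of $\tau\Delta$ the linear form $\sum_{i\notin F}w(F\cup\{i\})t_i$ is identically zero on $L_F$. If furthermore $(\Delta,L)$ is hereditary, then $f$ is strongly hereditary.
   Context: $D_\mathbf{u}=\sum u_i\partial_i$, $\partial^S=\prod_{i\in S}\partial_i$; lineality space $L_f=\{\mathbf{v}:D_\mathbf{v}f\equiv0\}$; $\Delta_f=\{S\subseteq V:\partial^Sf\not\equiv0\}$. The skeleton $\tau\Delta$ is $\Delta$ with all facets removed. For $S\in\Delta$, $V_S$ is the vertex set of the link $\mathrm{lk}_\Delta(S)=\{T:T\cap S=\varnothing,S\cup T\in\Delta\}$, and $L_S=\{(\ell_i)_{i\in V_S}:\ell\in L,\ \ell_j=0\text{ for all }j\in S\}$ (the linear form in the claim is in the variables $t_i$, $i\in V_F$, and is evaluated on $L_F$). A pair $(\Delta',L')$ is hereditary if for every $T\in\Delta'$ the map $\ell\mapsto(\ell_i)_{i\in T}$ maps $L'$ onto $\mathbb{R}^T$. A homogeneous polynomial $f$ of degree $d\ge1$ is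 hereditary if $(\tau\Delta_f,L_f)$ is hereditary and strongly hereditary if $(\Delta_f,L_f)$ is hereditary. *)

(* Defs.v *)
From HB Require Import structures.
From mathcomp Require Import all_boot all_order all_algebra.
From mathcomp Require Import reals.
From mathcomp Require Import mpoly.

Set Implicit Arguments.
Unset Strict Implicit.
Unset Printing Implicit Defensive.

Import GRing.Theory.
Local Open Scope ring_scope.

Section Complexes.
Variable V : finType.
Implicit Types (D : {set {set V}}) (S T F : {set V}).

(* Points of V need not be vertices: [set i] \notin D is allowed. *)
Definition simplicial_complex D : Prop :=
  set0 \in D /\ forall S T, S \in D -> T \subset S -> T \in D.

Definition facets D : {set {set V}} :=
  [set F in D | [forall G in D, ~~ (F \proper G)]].

(* Pure of dimension d - 1; a face with d elements has dimension d - 1. *)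
Definition pure_complex (d : nat) D : Prop :=
  simplicial_complex D /\ forall F, F \in facets D -> #|F| = d.

Definition skeleton D : {set {set V}} := D :\: facets D.

Definition link D S : {set {set V}} :=
  [set T : {set V} | [disjoint T & S] && (S :|: T \in D)].

Definition link_verts D S : {set V} := [set i | [set i] \in link D S].

End Complexes.

Section Hereditary.
Variables (R : realType) (V : finType).
Implicit Types (D : {set {set V}}) (S T F : {set V}).

(* R^V as a vector space; R^o is R viewed as a module over itself. *)
Definition vec := {ffun V -> R^o}.

Definition restr S (l : vec) : {ffun {i : V | i \in S} -> R} :=
  [ffun i => l (val i)].

Definition hereditary D (L : {pred vec}) : Prop :=
  forall T, T \in D ->
  forall y : {ffun {i : V | i \in T} -> R}, exists2 l, l \in L & restr T l = y.

(* The subspace L_S of R^(V_S), as a predicate. *)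
Definition link_space D (L : {pred vec}) S
    (x : {ffun {i : V | i \in link_verts D S} -> R}) : Prop :=
  exists l : vec,
    [/\ l \in L, forall j, j \in S -> l j = 0 & restr (link_verts D S) l = x].

(* The ring R[t_i : i in V] is {mpoly R[#|V|]}, where the variable t_i is
   'X_(enum_rank i). *)
Definition pderiv (i : V) (f : {mpoly R[#|V|]}) : {mpoly R[#|V|]} :=
  mderiv (enum_rank i) f.

Definition dderiv (u : vec) (f : {mpoly R[#|V|]}) : {mpoly R[#|V|]} :=
  \sum_(i : V) (u i : R) *: pderiv i f.

Definition pderivS S (f : {mpoly R[#|V|]}) : {mpoly R[#|V|]} :=
  foldr pderiv f (enum S).

Definition lineality (f : {mpoly R[#|V|]}) : {pred vec} :=
  [pred v : vec | dderiv v f == 0].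

Definition complex_of (f : {mpoly R[#|V|]}) : {set {set V}} :=
  [set S | pderivS S f != 0].

Definition hereditary_poly (f : {mpoly R[#|V|]}) : Prop :=
  exists2 e : nat, (0 < e)%N &
    f \is e.-homog /\ hereditary (skeleton (complex_of f)) (lineality f).

Definition strongly_hereditary_poly (f : {mpoly R[#|V|]}) : Prop :=
  exists2 e : nat, (0 < e)%N &
    f \is e.-homog /\ hereditary (complex_of f) (lineality f).

(* The linear form sum_(i notin F) w(F + i) t_i on R^(V_F). Every i in V_F lies
   outside F; the terms with i outside both F and V_F are zero, since F + i is
   then not a face and w is only nonzero on facets. *)
Definition link_form D (w : {set V} -> R) F
    (x : {ffun {i : V | i \in link_verts D F} -> R}) : R :=
  \sum_(i : {i : V | i \in link_verts D F}) w (val i |: F) * x i.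

Definition realizes (d : nat) D (L : {vspace vec}) (w : {set V} -> R)
    (f : {mpoly R[#|V|]}) : Prop :=
  [/\ hereditary_poly f,
      forall S, #|S| = d -> pderivS S f = (w S)%:MP_[#|V|],
      complex_of f = D
    & {subset L <= lineality f}].

End Hereditary.

Arguments link_space {R V} D L S x.
Arguments link_form {R V} D w F x.

(* Main.v *)
(** A homogeneous polynomial of positive degree whose partial derivatives all
vanish is zero (Euler).  If [S] is a non-facet face, hereditarity provides
[l] in [L] restricting to any unit vector of [R^S], so a polynomial annihilated
by [L] has all its partial derivatives determined by those in the directions
outside [S].  Hence [pderivS S f] is determined by the [pderivS (i |: S) f], and
descending induction on [#|S|] gives uniqueness.

Conversely, start from [f_S = w S] when [#|S| = d] and define [f_S] downwards as
the Euler primitive of the gradient so prescribed.  This gradient is closed and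
[f_S] is annihilated by [L] as soon as [sum_(i notin S) l_i f_(S + i) = 0] for
every [l] in [L] vanishing on [S].  For [#|S| = d - 1] this is the assumption on
the linear forms; for smaller [S] all the partial derivatives of the sum vanish
by induction. *)

Require Import Defs.
From HB Require Import structures.
From mathcomp Require Import all_boot all_order all_algebra.
From mathcomp Require Import reals.
From mathcomp Require Import mpoly.

Set Implicit Arguments.
Unset Strict Implicit.
Unset Printing Implicit Defensive.

Import Order.TTheory GRing.Theory Num.Theory.
Local Open Scope ring_scope.

(** * Faces and facets of pure complexes and of their skeletons *)

Section PureComplexes.
Variable V : finType.
Implicit Types (D : {set {set V}}) (S T F G : {set V}).

Lemma face_sub_facet D S : S \in D -> exists2 G, G \in facets D & S \subset G.
Proof.
move=> SD; have [G /maxsetP[GD Gmax] SG] := maxset_exists (P := mem D) SD.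
have {}GD : G \in D := GD.
exists G => //; rewrite inE GD; apply/forall_inP => H HD.
by apply/negP => /properP[GH [x xH /negP]]; rewrite -(Gmax H HD GH).
Qed.

(** Matches [pderivSU1], so that proofs about [pderivS] need not follow the order of [enum S]. *)
Lemma setU1_ind (P : {set V} -> Prop) :
  P set0 -> (forall i S, i \notin S -> P S -> P (i |: S)) -> forall S, P S.
Proof.
move=> P0 PS S; move cS: #|S| => n; elim: n S cS => [|n IHn] S cS.
  by move/eqP: cS; rewrite cards_eq0 => /eqP ->.
have [i iS] : exists i, i \in S by apply/set0Pn; rewrite -card_gt0 cS.
have iS' : i \notin S :\ i by rewrite !inE eqxx.
rewrite -(setD1K iS); apply: PS => //.
by apply: IHn; move: cS; rewrite (cardsD1 i) iS => -[].
Qed.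

Variables (d : nat) (D : {set {set V}}).
Hypothesis hD : pure_complex d D.

Lemma face_sub S T : S \in D -> T \subset S -> T \in D.
Proof. by case: hD => -[_ h] _; apply: h. Qed.

Lemma facet_face F : F \in facets D -> F \in D.
Proof. by rewrite inE => /andP[]. Qed.

Lemma card_facet F : F \in facets D -> #|F| = d.
Proof. by case: hD => _; apply. Qed.

Lemma card_face S : S \in D -> (#|S| <= d)%N.
Proof.
by case/face_sub_facet=> G /card_facet <- SG; apply: subset_leq_card.
Qed.

Lemma mem_facets S : (S \in facets D) = (S \in D) && (#|S| == d).
Proof.
apply/idP/andP => [SF|[SD /eqP cS]].
  by rewrite facet_face // card_facet.
have [G GF SG] := face_sub_facet SD.
suff -> : S = G by [].
by apply/eqP; rewrite eqEcard SG cS (card_facet GF) leqnn.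
Qed.

Lemma mem_skeleton S : (S \in skeleton D) = (S \in D) && (#|S| < d)%N.
Proof.
rewrite inE mem_facets andbC; case SD: (S \in D) => //=.
by rewrite ltn_neqAle card_face ?andbT.
Qed.

Lemma exists_facet : exists F, F \in facets D.
Proof.
by case: hD => -[/face_sub_facet[F FF _] _] _; exists F.
Qed.

(** By purity, a face with fewer than [d - 1] elements can take one more vertex of a facet and stay
    in the skeleton, so it is not maximal there. *)
Lemma mem_facets_skeleton F : (0 < d)%N ->
  (F \in facets (skeleton D)) = (F \in D) && (#|F|.+1 == d).
Proof.
move=> d_gt0; apply/idP/andP => [|[FD /eqP cF]].
  rewrite inE mem_skeleton -andbA => /and3P[FD Fd /forall_inP Fmax].
  split=> //; rewrite eqn_leq Fd leqNgt; apply/negP => Fd1.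
  have [G GF FG] := face_sub_facet FD.
  have /properP[_ [i iG iF]] : F \proper G.
    by rewrite properEcard FG (card_facet GF).
  have /Fmax : i |: F \in skeleton D.
    rewrite mem_skeleton cardsU1 iF Fd1 andbT.
    by apply: face_sub (facet_face GF) _; rewrite subUset sub1set iG.
  by rewrite properEcard subsetUr cardsU1 iF ltnS leqnn.
rewrite inE mem_skeleton FD -cF leqnn /=; apply/forall_inP => G.
rewrite mem_skeleton -cF ltnS => /andP[_ GF].
by rewrite properEcard ltnNge GF andbF.
Qed.

End PureComplexes.

(** * Derivatives of homogeneous polynomials, Euler's identity and primitives *)

Section DirectionalDerivatives.
Variables (R : realType) (V : finType).
Local Notation poly := {mpoly R[#|V|]}.
Implicit Types (f g p : poly) (i j : V) (S T : {set V}) (u l : vec R V).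

Lemma pderivC i j f : pderiv i (pderiv j f) = pderiv j (pderiv i f).
Proof. exact: mderiv_comm. Qed.

Lemma pderiv_sum (I : Type) (r : seq I) (P : pred I) (F : I -> poly) i :
  pderiv i (\sum_(k <- r | P k) F k) = \sum_(k <- r | P k) pderiv i (F k).
Proof. exact: raddf_sum. Qed.

Lemma pderivZ i (c : R) f : pderiv i (c *: f) = c *: pderiv i f.
Proof. exact: mderivZ. Qed.

Lemma pderivN i f : pderiv i (- f) = - pderiv i f.
Proof. exact: mderivN. Qed.

Lemma pderivB i f g : pderiv i (f - g) = pderiv i f - pderiv i g.
Proof. exact: mderivB. Qed.

Lemma pderiv0 i : pderiv i (0 : poly) = 0.
Proof. exact: mderiv0. Qed.

Lemma dderiv0 u : dderiv u (0 : poly) = 0.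
Proof. by rewrite /dderiv big1 // => i _; rewrite pderiv0 scaler0. Qed.

Lemma dderivB u f g : dderiv u (f - g) = dderiv u f - dderiv u g.
Proof.
by rewrite /dderiv -sumrB; apply: eq_bigr => i _; rewrite pderivB scalerBr.
Qed.

Lemma dderivZ u (c : R) f : dderiv u (c *: f) = c *: dderiv u f.
Proof.
rewrite /dderiv scaler_sumr; apply: eq_bigr => i _.
by rewrite pderivZ !scalerA mulrC.
Qed.

Lemma dderiv_sum (I : Type) (r : seq I) (P : pred I) (F : I -> poly) u :
  dderiv u (\sum_(k <- r | P k) F k) = \sum_(k <- r | P k) dderiv u (F k).
Proof.
rewrite /dderiv exchange_big; apply: eq_bigr => i _ /=.
by rewrite pderiv_sum scaler_sumr.
Qed.

Lemma pderiv_dderiv i u f : pderiv i (dderiv u f) = dderiv u (pderiv i f).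
Proof.
rewrite /dderiv pderiv_sum; apply: eq_bigr => j _.
by rewrite pderivZ pderivC.
Qed.

Lemma pderivS0 f : pderivS set0 f = f.
Proof. by rewrite /pderivS enum_set0. Qed.

(** Partial derivatives commute, so the fold depends on the list of indices only up to
    permutation. *)
Lemma pderivSU1 i S f : i \notin S ->
  pderivS (i |: S) f = pderiv i (pderivS S f).
Proof.
move=> iS; have foldE (s : seq V) :
    foldr (@pderiv R V) f s = foldr (@mderiv _ R) f (map enum_rank s).
  by elim: s => //= a s ->.
rewrite /pderivS -[RHS]/(foldr (@pderiv R V) f (i :: enum S)) !foldE.
apply/mderiv_perm/perm_map/uniq_perm; rewrite /= ?enum_uniq ?mem_enum ?iS //.
by move=> k; rewrite !(inE, mem_enum).
Qed.

Lemma pderivSB S f g : pderivS S (f - g) = pderivS S f - pderivS S g.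
Proof.
elim/setU1_ind: S => [|i S iS IH]; first by rewrite !pderivS0.
by rewrite !pderivSU1 // IH pderivB.
Qed.

Lemma pderivS_eq0_sub S T f : S \subset T -> pderivS S f = 0 ->
  pderivS T f = 0.
Proof.
move=> ST Sf; rewrite -(setUidPr ST); elim/setU1_ind: T {ST} => [|i T iT IH].
  by rewrite setU0.
rewrite setUCA; have [iST|iST] := boolP (i \in S :|: T).
  by rewrite (setUidPr _) // sub1set.
by rewrite pderivSU1 // IH pderiv0.
Qed.

Lemma dderiv_pderivS u S f : dderiv u f = 0 -> dderiv u (pderivS S f) = 0.
Proof.
move=> uf; elim/setU1_ind: S => [|i S iS IH]; first by rewrite pderivS0.
by rewrite pderivSU1 // -pderiv_dderiv IH pderiv0.
Qed.

Lemma mpolyC_homog (c : R) : c%:MP \is [in R[#|V|], 0.-homog].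
Proof.
by rewrite -[c]mulr1 mpolyCM mul_mpolyC; apply: rpredZ; apply: dhomog1.
Qed.

Lemma pderiv_homog n i f : f \is n.+1.-homog -> pderiv i f \is n.-homog.
Proof.
move=> fh; apply/dhomogP => m; rewrite mcoeff_msupp mcoeff_mderiv => nz.
apply/eqP; rewrite -eqSS -addn1 -(mdeg1 (enum_rank i)) -mdegD.
by apply: contraNT nz => nd; rewrite (dhomog_nemf_coeff fh) ?mul0rn.
Qed.

Lemma pderiv_homog0 i f : f \is 0.-homog -> pderiv i f = 0.
Proof.
move=> fh; apply/mpolyP => m; rewrite mcoeff_mderiv mcoeff0.
by rewrite (dhomog_nemf_coeff fh) ?mul0rn //= mdegD mdeg1 addn1.
Qed.

Lemma pderivS_homog n S f : f \is n.-homog ->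
  (#|S| <= n)%N -> pderivS S f \is (n - #|S|).-homog.
Proof.
move=> fh; elim/setU1_ind: S => [|i S iS IH].
  by rewrite cards0 subn0 pderivS0.
rewrite cardsU1 iS pderivSU1 // => Sn; apply: pderiv_homog.
by rewrite -subSn // subSS; apply/IH/ltnW.
Qed.

Lemma pderivS_homog_gt n S f : f \is n.-homog -> (n < #|S|)%N ->
  pderivS S f = 0.
Proof.
move=> fh; elim/setU1_ind: S => [|i S iS IH]; first by rewrite cards0.
rewrite cardsU1 iS pderivSU1 // ltnS leq_eqVlt => /orP[/eqP nS|/IH->].
  have := pderivS_homog (S := S) fh; rewrite nS subnn => /(_ (leqnn _)).
  exact: pderiv_homog0.
by rewrite pderiv0.
Qed.

Local Notation t i := ('X_(enum_rank i) : poly).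

(** By linearity it is enough to treat a monomial of exponent [m]: each summand multiplies it by one
    entry of [m], and these entries add up to [n]. *)
Lemma euler_homog n f : f \is n.-homog ->
  \sum_i t i * pderiv i f = n%:R *: f.
Proof.
move=> fh; rewrite [X in _ *: X]mpolyE scaler_sumr.
transitivity (\sum_(m <- msupp f) \sum_i t i * (f@_m *: pderiv i 'X_[m])).
  rewrite exchange_big; apply: eq_bigr => i _ /=.
  rewrite [X in pderiv _ X]mpolyE pderiv_sum mulr_sumr.
  by apply: eq_bigr => m _; rewrite pderivZ.
apply: eq_big_seq => m /(dhomog_mf fh) /= <-.
rewrite scalerA mulrC -scalerA scaler_nat.
transitivity (\sum_i f@_m *: ('X_[m] *+ m (enum_rank i))).
  apply: eq_bigr => i _; rewrite -scalerAr; congr (_ *: _).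
  rewrite /pderiv mderivX -scalerAr scaler_nat -mpolyXD.
  (* Subtraction of exponents is truncated, so [submK] needs a positive entry; for entry zero both
     sides vanish. *)
  case: (posnP (m (enum_rank i))) => [->|mi]; first by rewrite !mulr0n.
  by rewrite addmC submK // lep1mP -lt0n.
rewrite -scaler_sumr; congr (_ *: _).
rewrite -[LHS](big_morph _ (fun a b => mulrnDr 'X_[m] a b) (mulr0n _)).
congr (_ *+ _); rewrite mdegE (reindex enum_rank) //=.
exact: onW_bij (enum_rank_bij V).
Qed.

Lemma homog_pderiv_eq0 n f : f \is n.+1.-homog ->
  (forall i, pderiv i f = 0) -> f = 0.
Proof.
move=> /euler_homog fE df0; apply/eqP.
have : n.+1%:R *: f == 0.
  by rewrite -fE big1 // => i _; rewrite df0 mulr0.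
by rewrite scaler_eq0 pnatr_eq0.
Qed.

(* Poincare lemma: the primitive comes from Euler's identity. *)
Lemma homog_primitive n (g : V -> poly) :
  (forall i, g i \is n.-homog) ->
  (forall i j, pderiv i (g j) = pderiv j (g i)) ->
  let f := n.+1%:R^-1 *: \sum_i t i * g i in
  f \is n.+1.-homog /\ forall i, pderiv i f = g i.
Proof.
move=> gh gC f; split=> [|j].
  apply: rpredZ; apply: rpred_sum => i _; rewrite -add1n.
  by apply: dhomogM => //; rewrite dhomogX /= mdeg1.
rewrite /f pderivZ pderiv_sum.
(* Closedness turns [t i * pderiv j (g i)] into [t i * pderiv i (g j)], and these sum to
   [n%:R *: g j] by Euler; differentiating [t j] itself adds one more copy of [g j]. *)
under eq_bigr => i _ do rewrite /pderiv mderivM mderivX -!/(pderiv _ _) gC.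
rewrite big_split /= (euler_homog (gh j)).
rewrite (bigD1 j) //= big1 ?addr0 => [|i ij]; last first.
  rewrite mnm1E (inj_eq enum_rank_inj) (negPf ij).
  by rewrite scale0r mul0r.
rewrite mnm1E eqxx scale1r -{1}[U_(_)%MM]add0m addmK mpolyX0 mul1r.
rewrite -[X in X + _]scale1r -scalerDl nat1r.
by rewrite scalerA mulVf ?scale1r // pnatr_eq0.
Qed.



(** On [S] the vector [l] is the unit vector at [j], so inside [S] only the term of [j] survives in
    [dderiv l p]. *)
Lemma pderiv_lineality S l j p : j \in S ->
    (forall i, i \in S -> l i = (i == j)%:R) -> dderiv l p = 0 ->
  pderiv j p = - \sum_(i | i \notin S) (l i : R) *: pderiv i p.
Proof.
move=> jS lS; rewrite /dderiv (bigID (mem S)) /= (bigD1 j) //= big1.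
  rewrite addr0 lS // eqxx scale1r => /eqP; rewrite addr_eq0 => /eqP.
  exact.
by move=> i /andP[iS /negPf ij]; rewrite lS // ij scale0r.
Qed.

(** Derivatives inside [S] are combinations of those outside, so all of them vanish. This serves
    both uniqueness and the propagation of the link relation. *)
Lemma homog_eq0_lineality n S p : p \is n.+1.-homog ->
    (forall j, j \in S -> exists2 l, dderiv l p = 0 &
       forall i, i \in S -> l i = (i == j)%:R) ->
    (forall i, i \notin S -> pderiv i p = 0) ->
  p = 0.
Proof.
move=> ph lS off; apply: (homog_pderiv_eq0 ph) => j.
have [jS|/off//] := boolP (j \in S).
have [l lp le] := lS j jS; rewrite (pderiv_lineality jS le lp).
by rewrite big1 ?oppr0 // => i /off ->; rewrite scaler0.
Qed.

End DirectionalDerivatives.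

(** * Hereditary pairs and the linear forms on links *)

Section HereditaryPairs.
Variables (R : realType) (V : finType).
Implicit Types (D : {set {set V}}) (S : {set V}).

Lemma hereditary_coord D (L : {pred vec R V}) S j :
  hereditary D L -> S \in D ->
  exists2 l, l \in L & forall i, i \in S -> l i = (i == j)%:R.
Proof.
move=> hL /hL/(_ [ffun i => (val i == j)%:R])[l lL /ffunP lE].
by exists l => // i iS; have := lE (exist _ i iS); rewrite !ffunE.
Qed.

Lemma hereditary_subset D (L L' : {pred vec R V}) :
  {subset L <= L'} -> hereditary D L -> hereditary D L'.
Proof. by move=> LL' hL T /hL h y; have [l /LL'] := h y; exists l. Qed.

Lemma mem_link_verts D S i :
  (i \in link_verts D S) = (i \notin S) && (i |: S \in D).
Proof.
by rewrite !inE setUC disjoints1.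
Qed.

(** The added terms have [i |: S] outside [D], hence weight zero. The sum over all [i \notin S] is
    the form used in the proofs below. *)
Lemma link_form_restr D (w : {set V} -> R) S (l : vec R V) :
  (forall i, i \notin S -> i |: S \notin D -> w (i |: S) = 0) ->
  link_form D w S (restr (link_verts D S) l) =
    \sum_(i | i \notin S) w (i |: S) * l i.
Proof.
move=> w0; rewrite /link_form.
under eq_bigr do rewrite ffunE.
rewrite -(big_sub (mem (link_verts D S)) (fun i => w (i |: S) * l i)).
rewrite [RHS](bigID (fun i => i |: S \in D)) /= [X in _ + X]big1 ?addr0.
  by apply: eq_bigl => i; rewrite mem_link_verts.
by move=> i /andP[/w0 h /h ->]; rewrite mul0r.
Qed.

End HereditaryPairs.

(** * Construction of the polynomial from the weights *)

Section Construction.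
Variables (R : realType) (V : finType) (d : nat) (D : {set {set V}}).
Variables (L : {vspace vec R V}) (w : {set V} -> R).
Variable lam : {set V} -> V -> vec R V.
Local Notation poly := {mpoly R[#|V|]}.
Local Notation t i := ('X_(enum_rank i) : poly).
Implicit Types (S T : {set V}) (i j k : V).

(* The gradient forced on a polynomial whose derivatives along [i \notin S] are
   [F (i |: S)] and which is killed by the directions [lam S j], whose
   restriction to [S] is the [j]-th unit vector. *)
Definition face_grad (F : {set V} -> poly) S i : poly :=
  if i \in S then - \sum_(k | k \notin S) (lam S i k : R) *: F (k |: S)
  else F (i |: S).

(* [face_poly n S], for [#|S| + n = d], is the future [pderivS S f]. *)
Fixpoint face_poly n S : poly :=
  if n is m.+1 then
    if S \in D then n%:R^-1 *: \sum_i t i * face_grad (face_poly m) S i else 0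
  else (w S)%:MP.

Hypothesis hD : pure_complex d D.
Hypothesis lamL : forall S j, S \in skeleton D -> lam S j \in L.
Hypothesis lamS : forall S j i, S \in skeleton D -> i \in S ->
  lam S j i = (i == j)%:R.
Hypothesis w0 : forall S, #|S| = d -> S \notin D -> w S = 0.
Hypothesis wL : forall S, S \in D -> #|S|.+1 = d ->
  forall l, l \in L -> (forall j, j \in S -> l j = 0) ->
  \sum_(i | i \notin S) w (i |: S) * l i = 0.

(** These properties form one induction hypothesis, since the step at [S] draws on them together at
    every [i |: S]. The equation [n = m.+1] makes the last clause vacuous at the bottom level. *)
Definition face_poly_spec n S : Prop :=
  [/\ face_poly n S \is n.-homog,
      forall l, l \in L -> dderiv l (face_poly n S) = 0,
      S \notin D -> face_poly n S = 0
    & forall m i, n = m.+1 -> i \notin S ->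
        pderiv i (face_poly n S) = face_poly m (i |: S)].

(** * One step of the descending induction, at a face of the skeleton *)

Section Step.
Variables (n : nat) (S : {set V}).
Hypothesis IH : forall i, i \notin S -> face_poly_spec n (i |: S).
Hypotheses (SD : S \in D) (cS : (#|S| + n.+1 = d)%N).
Let h i := face_poly n (i |: S).
Let g := face_grad (face_poly n) S.

Let Ssk : S \in skeleton D.
Proof. by rewrite (mem_skeleton hD) SD -cS addnS ltnS leq_addr. Qed.

Let h_homog i : i \notin S -> h i \is n.-homog.
Proof. by case/IH. Qed.

Let h_lineality l i : l \in L -> i \notin S -> dderiv l (h i) = 0.
Proof. by move=> lL /IH[_ + _ _]; apply. Qed.

(** For [i] and [k] distinct, both sides are the polynomial attached to [S] with [i] and [k] added,
    or zero when [n] is zero. *)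
Lemma pderiv_face_polyC i k : i \notin S -> k \notin S ->
  pderiv k (h i) = pderiv i (h k).
Proof.
move=> iS kS; have [->//|ik] := eqVneq i k.
have ki : k \notin i |: S by rewrite !inE negb_or eq_sym ik.
have ik' : i \notin k |: S by rewrite !inE negb_or ik.
move: IH h_homog; rewrite /h; case: n => [|m] IH' hh.
  by rewrite !pderiv_homog0 ?hh.
have [_ _ _ Hi] := IH' i iS; have [_ _ _ Hk] := IH' k kS.
by rewrite (Hi m) // (Hk m) // setUCA.
Qed.

Lemma face_grad_homog i : g i \is n.-homog.
Proof.
rewrite /g /face_grad; case: ifPn => [_|/h_homog//].
by rewrite dhomogN; apply: rpred_sum => k /h_homog; apply: rpredZ.
Qed.

Lemma pderiv_in_face i j : i \notin S -> j \in S ->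
  pderiv j (h i) = - \sum_(k | k \notin S) (lam S j k : R) *: pderiv k (h i).
Proof.
move=> iS jS; apply: (pderiv_lineality jS); first by move=> k; apply: lamS.
by apply: h_lineality => //; apply: lamL.
Qed.

(** Outside [S] this is [pderiv_face_polyC], and mixed indices follow from [pderiv_in_face]. With
    both indices in [S], expanding by [pderiv_in_face] gives a double sum symmetric in [i] and
    [j]. *)
Lemma face_grad_closed i j : pderiv i (g j) = pderiv j (g i).
Proof.
have mixed a b : a \notin S -> b \in S -> pderiv a (g b) = pderiv b (g a).
  move=> aS bS; rewrite /g /face_grad bS (negPf aS) (pderiv_in_face aS bS).
  rewrite pderivN pderiv_sum; congr (- _); apply: eq_bigr => k kS.
  by rewrite pderivZ (pderiv_face_polyC kS aS).
have [iS|iS] := boolP (i \in S); have [jS|jS] := boolP (j \in S).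
- rewrite /g /face_grad iS jS !pderivN !pderiv_sum; congr (- _).
  transitivity (- \sum_(k | k \notin S) \sum_(m | m \notin S)
     ((lam S j k : R) * lam S i m) *: pderiv m (h k)).
    rewrite -sumrN; apply: eq_bigr => k kS.
    rewrite pderivZ (pderiv_in_face kS iS) scalerN scaler_sumr.
    by congr (- _); apply: eq_bigr => m _; rewrite scalerA.
  rewrite exchange_big -sumrN; apply: eq_bigr => k kS /=.
  rewrite pderivZ (pderiv_in_face kS jS) scalerN scaler_sumr.
  congr (- _); apply: eq_bigr => m mS.
  by rewrite scalerA mulrC (pderiv_face_polyC mS kS).
- by rewrite -mixed.
- by rewrite mixed.
- by rewrite /g /face_grad (negPf iS) (negPf jS) pderiv_face_polyC.
Qed.

(* In degree zero this is the hypothesis on the weights; in positive degree it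
   propagates because all derivatives of the sum vanish. *)
Lemma link_relation l : l \in L -> (forall j, j \in S -> l j = 0) ->
  \sum_(i | i \notin S) (l i : R) *: h i = 0.
Proof.
move=> lL lS; set p := LHS.
have ph : p \is n.-homog.
  by apply: rpred_sum => k /h_homog; apply: rpredZ.
have pL m : m \in L -> dderiv m p = 0.
  move=> mL; rewrite dderiv_sum big1 // => i iS.
  by rewrite dderivZ h_lineality ?scaler0.
(* Swapping indices by [pderiv_face_polyC] identifies [pderiv k p] with [dderiv l (h k)], because
   [l] vanishes on [S]. *)
have off k : k \notin S -> pderiv k p = 0.
  move=> kS; rewrite -(h_lineality lL kS) pderiv_sum /dderiv.
  rewrite [RHS](bigID (mem S)) /=.
  rewrite [X in _ = X + _]big1 ?add0r => [|i iS]; last first.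
    by rewrite (lS i iS : l i = 0 :> R) scale0r.
  by apply: eq_bigr => i iS; rewrite pderivZ (pderiv_face_polyC iS kS).
case: (posnP n) => [n0|n_gt0].
  rewrite /p /h n0 /=.
  have := wL SD _ lL lS; rewrite -cS n0 addn1 => /(_ erefl) wE.
  transitivity ((\sum_(i | i \notin S) w (i |: S) * l i)%:MP : poly).
    rewrite raddf_sum; apply: eq_bigr => i iS.
    by rewrite -mul_mpolyC -mpolyCM mulrC.
  by rewrite wE mpolyC0.
rewrite -(prednK n_gt0) in ph.
apply: (homog_eq0_lineality ph _ off) => j jS.
by exists (lam S j); [apply: pL; apply: lamL | move=> i; apply: lamS].
Qed.

(** This says that the primitive of [g] is annihilated by [L]. *)
Lemma face_grad_lineality l : l \in L -> \sum_i (l i : R) *: g i = 0.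
Proof.
(* [m] is [l] with its coordinates on [S] cleared inside [L]; the link relation for [m] rearranges
   to the claim. *)
move=> lL; pose m : vec R V := l - \sum_(j in S) (l j : R) *: lam S j.
have mE k : m k = l k - \sum_(j in S) l j * lam S j k.
  rewrite /m !ffunE sum_ffunE; congr (_ - _).
  by apply: eq_bigr => j _; rewrite ffunE.
have mL : m \in L.
  by apply: rpredB => //; apply: rpred_sum => j jS; apply/rpredZ/lamL.
have mS j : j \in S -> m j = 0.
  move=> jS; rewrite mE (bigD1 j) //= big1 => [|k /andP[kS kj]].
    by rewrite lamS // eqxx mulr1 addr0 subrr.
  by rewrite lamS // eq_sym (negPf kj) mulr0.
rewrite -[RHS](link_relation mL mS) [LHS](bigID (mem S)) /= addrC.
under [in RHS]eq_bigr do rewrite mE scalerBl.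
rewrite sumrB; congr (_ + _).
  by apply: eq_bigr => i iS; rewrite /g /face_grad (negPf iS).
under [in RHS]eq_bigr do rewrite scaler_suml.
rewrite exchange_big -sumrN; apply: eq_bigr => j jS /=.
rewrite /g /face_grad jS scalerN scaler_sumr; congr (- _).
by apply: eq_bigr => k _; rewrite scalerA.
Qed.

Lemma face_polyS_spec : face_poly_spec n.+1 S.
Proof.
have [ph pg] := homog_primitive face_grad_homog face_grad_closed.
rewrite /face_poly_spec /= SD; split=> // [l lL|m i [<-] iS].
  rewrite -[RHS](face_grad_lineality lL).
  by apply: eq_bigr => i _; rewrite pg.
by rewrite pg /g /face_grad (negPf iS).
Qed.

End Step.

Lemma face_polyP n S : (#|S| + n = d)%N -> face_poly_spec n S.
Proof.
elim: n S => [|n IH] S cS.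
  split=> /= [|l lL|SD|//]; first exact: mpolyC_homog.
    by rewrite /dderiv big1 // => i _; rewrite /pderiv mderivC scaler0.
  by rewrite w0 ?mpolyC0 // -cS addn0.
have IHi i : i \notin S -> face_poly_spec n (i |: S).
  by move=> iS; apply: IH; rewrite cardsU1 iS -cS addnS addSn.
have [SD|SD] := boolP (S \in D); first exact: face_polyS_spec.
rewrite /face_poly_spec /= (negPf SD); split=> //.
- exact: dhomog0.
- by move=> l _; rewrite dderiv0.
(* A superset of a non-face is a non-face, so its polynomial is zero as well. *)
move=> m i [<-] iS; rewrite pderiv0; have [_ _ -> //] := IHi i iS.
by apply: contra SD => /(face_sub hD); apply; apply: subsetUr.
Qed.

Lemma pderivS_face_poly S : (#|S| <= d)%N ->
  pderivS S (face_poly d set0) = face_poly (d - #|S|) S.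
Proof.
elim/setU1_ind: S => [|i S iS IH]; first by rewrite pderivS0 cards0 subn0.
rewrite cardsU1 iS add1n => Sd; rewrite pderivSU1 // IH; last exact: ltnW.
have [|_ _ _ h] := @face_polyP (d - #|S|) S; first by rewrite subnKC // ltnW.
by apply: h => //; rewrite subnSK.
Qed.

Lemma face_poly_realizes : (0 < d)%N ->
    (forall F, F \in facets D -> w F <> 0) -> hereditary (skeleton D) L ->
  realizes d D L w (face_poly d set0).
Proof.
move=> d_gt0 w_neq0 hL; set f := face_poly d set0.
have [|fh fL _ _] := @face_polyP d set0; first by rewrite cards0.
have wE S : #|S| = d -> pderivS S f = (w S)%:MP_[#|V|].
  by move=> cS; rewrite pderivS_face_poly ?cS // subnn.
have fD : complex_of f = D.
  apply/setP => S; rewrite inE; apply/idP/idP => [|SD].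
    apply: contraR => SD; apply/eqP.
    have [Sd|Sd] := leqP #|S| d; last exact: pderivS_homog_gt fh Sd.
    rewrite pderivS_face_poly //.
    by have [|_ _ ->] := @face_polyP (d - #|S|) S; rewrite ?subnKC.
  (* A vanishing derivative along [S] would force the nonzero constant [w G] of a facet [G] above
     [S] to vanish. *)
  have [G GF SG] := face_sub_facet SD; apply/eqP => /(pderivS_eq0_sub SG).
  rewrite wE ?(card_facet hD) // => /eqP; rewrite mpolyC_eq0 => /eqP.
  exact: w_neq0.
have subL : {subset L <= lineality f}.
  by move=> l /fL lf; rewrite inE; apply/eqP.
split=> //; exists d => //; split=> //.
by rewrite fD; apply: hereditary_subset hL.
Qed.

End Construction.

(** * Uniqueness, and necessity and sufficiency of the link condition *)

Section Realizations.
Variables (R : realType) (V : finType) (d : nat) (D : {set {set V}}).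
Variables (L : {vspace vec R V}) (w : {set V} -> R).
Hypothesis hD : pure_complex d D.
Hypothesis hw : forall S : {set V}, #|S| = d -> (w S <> 0 <-> S \in facets D).
Implicit Types (f g : {mpoly R[#|V|]}) (S F : {set V}).

Lemma weight_eq0 S : #|S| = d -> S \notin D -> w S = 0.
Proof.
move=> cS SD; apply/eqP; apply/negPn/negP => /eqP /(hw cS) /facet_face.
exact/negP.
Qed.

(** [hereditary_poly] only provides some degree [e]. It equals [d] because the derivative along a
    facet is a nonzero constant. *)
Lemma realizes_homog f : realizes d D L w f -> f \is d.-homog.
Proof.
case=> -[e _ [fh _]] wE _ _; have [F FF] := exists_facet hD.
have cF := card_facet hD FF; have := wE F cF.
have /eqP wF := (hw cF).2 FF.
have [Fe|Fe] := leqP #|F| e => FE; last first.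
  move: FE wF; rewrite (pderivS_homog_gt fh Fe) => /esym/eqP.
  by rewrite mpolyC_eq0 => ->.
suff -> : d = e by [].
have := pderivS_homog fh Fe; rewrite FE => h.
have nz : (w F)%:MP_[#|V|] != 0 by rewrite mpolyC_eq0.
have /eqP := dhomog_uniq nz h (mpolyC_homog _ _); rewrite subn_eq0 => eF.
by apply/eqP; rewrite eqn_leq -{1}cF Fe -cF.
Qed.

Lemma realizes_unique f g : hereditary (skeleton D) L ->
  realizes d D L w f -> realizes d D L w g -> f = g.
Proof.
move=> hL hf hg; apply/eqP; rewrite -subr_eq0 -[f - g]pderivS0; apply/eqP.
have fgh : f - g \is d.-homog by rewrite rpredB ?realizes_homog.
case: hf hg => _ wf fD Lf [_ wg gD Lg].
have lin l : l \in L -> dderiv l (f - g) = 0.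
  move=> lL; have := Lf l lL; have := Lg l lL; rewrite !inE dderivB.
  by move=> /eqP -> /eqP ->; rewrite subrr.
(* Here [n] is the degree left after differentiating along [S]; the goal is the case of empty
   [S]. *)
suff H n S : (#|S| + n = d)%N -> pderivS S (f - g) = 0.
  by apply: (H d); rewrite cards0.
elim: n S => [|n IH] S cS.
  by rewrite pderivSB wf ?wg ?subrr // -cS addn0.
(* Along a non-face both derivatives vanish, since both polynomials have complex [D]. *)
have [SD|SD] := boolP (S \in D); last first.
  have := SD; rewrite -{1}fD inE negbK => /eqP fS.
  have := SD; rewrite -{1}gD inE negbK => /eqP gS.
  by rewrite pderivSB fS gS subrr.
have Sd : (#|S| < d)%N by rewrite -cS addnS ltnS leq_addr.
have ph : pderivS S (f - g) \is n.+1.-homog.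
  by have := pderivS_homog fgh (ltnW Sd); rewrite -cS addKn.
apply: (homog_eq0_lineality (S := S) ph) => [j jS|i iS].
  have [|l lL lS] := hereditary_coord j hL (S := S).
    by rewrite (mem_skeleton hD) SD.
  by exists l => //; apply/dderiv_pderivS/lin.
by rewrite -pderivSU1 // IH // cardsU1 iS -cS addnS addSn.
Qed.

(** Apply [dderiv l] to [pderivS F f]: the directions in [F] drop out, and the remaining derivatives
    are the constants [w (i |: F)]. *)
Lemma realizes_link_form f F (l : vec R V) :
    realizes d D L w f -> #|F|.+1 = d -> l \in L ->
    (forall j, j \in F -> l j = 0) ->
  \sum_(i | i \notin F) w (i |: F) * l i = 0.
Proof.
move=> [_ wf _ Lf] cF lL lF; apply/eqP; rewrite -(mpolyC_eq0 #|V|); apply/eqP.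
have := Lf l lL; rewrite inE => /eqP /(dderiv_pderivS F).
move=> <-; rewrite /dderiv [RHS](bigID (mem F)) /=.
rewrite [X in _ = X + _]big1 ?add0r => [|i iF]; last first.
  by rewrite (lF i iF : l i = 0 :> R) scale0r.
rewrite raddf_sum; apply: eq_bigr => i iF /=.
by rewrite -pderivSU1 // wf ?cardsU1 ?iF // -mul_mpolyC -mpolyCM mulrC.
Qed.

Lemma realizable_of_link_form : (0 < d)%N -> hereditary (skeleton D) L ->
    (forall S, S \in D -> #|S|.+1 = d ->
      forall l, l \in L -> (forall j, j \in S -> l j = 0) ->
      \sum_(i | i \notin S) w (i |: S) * l i = 0) ->
  exists f, realizes d D L w f.
Proof.
move=> d_gt0 hL wL.
(* Finite choice over pairs of a set and a vertex yields all directions at once; off the skeleton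
   [0] is a dummy value. *)
have coord (Sj : {set V} * V) : exists l : vec R V, Sj.1 \in skeleton D ->
    l \in L /\ forall i, i \in Sj.1 -> l i = (i == Sj.2)%:R.
  have [SD|SD] := boolP (Sj.1 \in skeleton D); last by exists 0.
  by have [l lL lS] := hereditary_coord Sj.2 hL SD; exists l.
have [lam lamP] := fin_all_exists coord.
exists (face_poly D w (fun S j => lam (S, j)) d set0).
apply: face_poly_realizes => //.
- by move=> S j /(lamP (S, j))[].
- by move=> S j i /(lamP (S, j))[_]; apply.
- exact: weight_eq0.
- by move=> F FF; apply/(hw (card_facet hD FF)).
Qed.

End Realizations.

(** * Uniqueness, the existence criterion and strong heredity combined *)

Theorem theorem3p13 (R : realType) (V : finType) (d : nat) (D : {set {set V}})
    (L : {vspace (vec R V)}) (w : {set V} -> R) (hd : (0 < d)%N)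
    (hD : pure_complex d D) (hL : hereditary (skeleton D) L)
    (hw : forall S : {set V}, #|S| = d -> (w S <> 0 <-> S \in facets D)) :
  [/\ forall f g : {mpoly R[#|V|]},
        realizes d D L w f -> realizes d D L w g -> f = g,
      (exists f : {mpoly R[#|V|]}, realizes d D L w f) <->
        (forall F : {set V}, F \in facets (skeleton D) ->
          forall x : {ffun {i : V | i \in link_verts D F} -> R},
            link_space D L F x -> link_form D w F x = 0)
    & hereditary D L ->
        forall f : {mpoly R[#|V|]},
          realizes d D L w f -> strongly_hereditary_poly f].
Proof.
have linkE (F : {set V}) (l : vec R V) : #|F|.+1 = d ->
    link_form D w F (restr (link_verts D F) l) =
    \sum_(i | i \notin F) w (i |: F) * l i.
  move=> cF; apply: link_form_restr => i iF.
  by apply: (weight_eq0 hw); rewrite cardsU1 iF.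
split=> [f g|| hDL f hf]; first exact: realizes_unique.
- split=> [[f hf] F|wL].
    rewrite (mem_facets_skeleton hD) // => /andP[_ /eqP cF] x [l [lL lF <-]].
    by rewrite linkE // (realizes_link_form hf).
  apply: realizable_of_link_form => // S SD cS l lL lS.
  rewrite -linkE //; apply: wL; last by exists l.
  by rewrite (mem_facets_skeleton hD) // SD cS eqxx.
(* Surjectivity of the restrictions passes from [L] to the larger space [lineality f]. *)
exists d => //; split; first exact: realizes_homog hf.
by case: hf => _ _ -> Lf; apply: hereditary_subset Lf hDL.
Qed.
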